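(* There exist absolute constants $c,C>0$ and $n_0$ such that for all $n\ge n_0$, $\delta\in(0,1/2]$ and $\varepsilon\in(0,1]$ with $\varepsilon\ge c\sqrt{\log n\log(1/\delta)/n}$, there is an $(\varepsilon,\delta)$-LNDP algorithm $\mathcal{A}$ on $n$-node graphs such that for every $p\in[0,1]$, \[ \Pr\Big[|\mathcal{A}(G)-p|\le C\,\frac{\sqrt{\log n}}{n}\cdot\frac{\sqrt{\log(1/\delta)}}{\varepsilon}\Big]\ge\frac23, \] where the probability is over $G\sim G(n,p)$ and the coins of $\mathcal{A}$.
   Context: Graphs are simple and undirected on node set $[n]$; $N_i^G$ is the neighborhood of node $i$. $G(n,p)$ is the Erdős–Rényi distribution (each edge present independently with probability $p$). Two graphs on $[n]$ are node neighbors if they differ only in edges incident to a single node. Random variables $R_1,R_2$ are $(\varepsilon,\delta)$-indistinguishable if for every event $Y$, $\Pr[R_1\in Y]\le e^\varepsilon\Pr[R_2\in Y]+\delta$ and symmetrically. An algorithm $\mathcal{A}$ on $n$-node graphs is (noninteractive) $(\varepsilon,\delta)$-LNDP if there exist a distribution over public random strings $\rho$, local randomizers $\mathcal{R}_{1,\rho},\dots,\mathcal{R}_{n,\rho}$ (with independent internal randomness), and a postprocessing $\mathcal{P}$ with $\mathcal{A}(G)=\mathcal{P}(\mathcal{R}_{1,\rho}(N_1^G),\dots,\mathcal{R}_{n,\rho}(N_n^G))$, such that for every fixed $\rho$ and every node-neighboring $G,G'$ the randomizer output vectors on $G$ and $G'$ are $(\varepsilon,\delta)$-indistinguishable. *)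

(* Defs.v *)
From HB Require Import structures.
From mathcomp Require Import all_boot all_order all_algebra.
From mathcomp Require Import all_classical all_reals all_analysis.
Set Implicit Arguments.
Unset Strict Implicit.
Unset Printing Implicit Defensive.
Import Order.TTheory GRing.Theory Num.Theory.
Local Open Scope ring_scope.

Definition graph (n : nat) := {set {set 'I_n}}.

Definition simple_graph n (E : graph n) : bool := [forall e in E, #|e| == 2%N].

Definition nbhd n (E : graph n) (i : 'I_n) : {set 'I_n} := [set j | [set i; j] \in E].

Definition node_neighbors n (E E' : graph n) : Prop :=
  exists v : 'I_n, forall e : {set 'I_n}, v \notin e -> (e \in E) = (e \in E').

Definition gnp_weight (R : realType) n (p : R) (E : graph n) : R :=
  \prod_(e : {set 'I_n} | #|e| == 2%N) (if e \in E then p else 1 - p).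

Local Open Scope classical_set_scope.

(* A noninteractive local algorithm on n-node graphs, given through an explicit
   probability space carrying the public random string and the independent
   internal coins of the n local randomizers. *)
Record local_alg (R : realType) (n : nat) := LocalAlg {
  dOm : measure_display; Om : measurableType dOm; Pr : probability Om R;
  dRho : measure_display; Rho : measurableType dRho;
  dS : measure_display; Coin : measurableType dS;
  dY : measure_display; Msg : measurableType dY;
  rho : Om -> Rho;
  coin : 'I_n -> Om -> Coin;
  rand : 'I_n -> {set 'I_n} -> Rho * Coin -> Msg;
  post : n.-tuple Msg -> R
}.

Arguments dOm {R n}. Arguments Om {R n}. Arguments Pr {R n}.
Arguments dRho {R n}. Arguments Rho {R n}. Arguments dS {R n}. Arguments Coin {R n}.
Arguments dY {R n}. Arguments Msg {R n}. Arguments rho {R n}. Arguments coin {R n}.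
Arguments rand {R n}. Arguments post {R n}.

Section LocalAlg.
Variables (R : realType) (n : nat) (A : local_alg R n).

Definition local_alg_wf : Prop :=
  [/\ measurable_fun setT (rho A),
      (forall i, measurable_fun setT (coin A i)),
      (forall i N, measurable_fun setT (rand A i N)),
      measurable_fun setT (post A) &
      (forall (B : set (Rho A)) (C : 'I_n -> set (Coin A)),
         measurable B -> (forall i, measurable (C i)) ->
         Pr A (rho A @^-1` B `&` \bigcap_(i in [set: 'I_n]) (coin A i @^-1` C i)) =
         (Pr A (rho A @^-1` B) * \prod_(i < n) Pr A (coin A i @^-1` C i))%E)].

Definition rand_outputs (r : Rho A) (E : graph n) : Om A -> n.-tuple (Msg A) :=
  fun w => [tuple rand A i (nbhd E i) (r, coin A i w) | i < n].

Definition alg_output (E : graph n) : Om A -> R :=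
  fun w => post A [tuple rand A i (nbhd E i) (rho A w, coin A i w) | i < n].

End LocalAlg.
Arguments local_alg_wf {R n} A.
Arguments rand_outputs {R n} A r E.
Arguments alg_output {R n} A E.

Definition indist (R : realType) d (Om : measurableType d) (P : probability Om R)
    dy (Y : measurableType dy) (X1 X2 : Om -> Y) (eps delta : R) : Prop :=
  forall B : set Y, measurable B ->
    (P (X1 @^-1` B) <= (expR eps)%:E * P (X2 @^-1` B) + delta%:E)%E /\
    (P (X2 @^-1` B) <= (expR eps)%:E * P (X1 @^-1` B) + delta%:E)%E.

Definition LNDP (R : realType) n (A : local_alg R n) (eps delta : R) : Prop :=
  forall (r : Rho A) (E E' : graph n),
    simple_graph E -> simple_graph E' -> node_neighbors E E' ->
    indist (Pr A) (rand_outputs A r E) (rand_outputs A r E') eps delta.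

Definition gnp_prob (R : realType) n (A : local_alg R n) (p : R) (T : set R) : \bar R :=
  (\sum_(E : graph n | simple_graph E)
      (gnp_weight p E)%:E * Pr A (alg_output A E @^-1` T))%E.

(* Main.v *)
(* Privacy comes from randomized response instead of additive noise.  Put w = 4 sqrt(n ln n) and let
   hat_0, hat_1, ... be the piecewise linear partition of unity on the integer grid.  Node i, of degree d,
   publishes for every bin j an independent sign of mean alpha * hat_j (d / w), where
   alpha = eps / (16 sqrt(ln (1 / delta))).  Rewiring one node changes the vector of its own hats by O(1)
   in l2, and the degree of any other node by at most 1, hence its hats by O(1 / w); the total squared
   change of the means is O(alpha^2), and a Chernoff bound on the log-likelihood ratio gives
   (eps, delta)-indistinguishability.

   In G(n,p) all degrees lie within w of p(n-1), so all the mass of the histogram sits in O(1) bins.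
   As n alpha >> sqrt(n ln n), the largest of the noisy bins is one of them.  Since
   sum_j j hat_j(x) = x, the mean degree is read off the O(1) bins around that peak, with an error of
   order w / (alpha sqrt n), and the density is the mean degree divided by n-1. *)
Require Import Defs.
From HB Require Import structures.
From mathcomp Require Import all_boot all_order all_algebra.
From mathcomp Require Import all_classical all_reals all_analysis.
From mathcomp Require Import zify ring lra.
Import Order.TTheory GRing.Theory Num.Theory.
Local Open Scope ring_scope.

(** * Exponential moments and tail bounds on finite probability spaces *)

Section Concentration.
Context {R : realType}.

(* On [x <= 1/2] this follows from [exp(-x) >= 1 - x]; beyond, [x <= 2 x^2]. *)
Lemma expR_le_addr (x : R) : expR x <= x + expR (2 * x ^+ 2).
Proof.
have [x_le|/ltW x_ge] := leP x (1 / 2); last first.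
  have : expR x <= expR (2 * x ^+ 2) by rewrite ler_expR; nra.
  by lra.
have x1 : 0 < 1 - x by lra.
have : expR x <= (1 - x)^-1.
  rewrite -[x in expR x]opprK expRN lef_pV2 ?posrE ?expR_gt0//.
  exact: expR_ge1Dx.
have : (1 - x)^-1 <= 1 + x + 2 * x ^+ 2.
  by rewrite -div1r ler_pdivrMr//; nra.
have := expR_ge1Dx (2 * x ^+ 2).
by lra.
Qed.

Lemma expRN_le_inv (x : R) : 0 < x -> expR (- x) <= x^-1.
Proof.
move=> x0; rewrite expRN lef_pV2 ?posrE ?expR_gt0//.
by have := expR_ge1Dx x; lra.
Qed.

(** Bounding each exponential by [expR_le_addr] leaves a linear term, which the zero mean cancels,
    and a quadratic term controlled by [b]. *)
Lemma subgaussian_mgf (T : finType) (q z : T -> R) (b lam : R) :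
  (forall t, 0 <= q t) -> \sum_t q t = 1 -> \sum_t q t * z t = 0 ->
  (forall t, z t ^+ 2 <= b) ->
  \sum_t q t * expR (lam * z t) <= expR (2 * lam ^+ 2 * b).
Proof.
move=> q0 q1 qz zb.
apply: (@le_trans _ _ (\sum_t (lam * (q t * z t) + q t * expR (2 * lam ^+ 2 * b)))).
  apply: ler_sum => t _.
  rewrite mulrCA -mulrDr ler_wpM2l//.
  apply: (le_trans (expR_le_addr _)); rewrite lerD2l ler_expR exprMn mulrA.
  by rewrite ler_wpM2l// mulr_ge0// sqr_ge0.
by rewrite big_split/= -mulr_sumr qz mulr0 add0r -mulr_suml q1 mul1r.
Qed.

Lemma chernoff (T : finType) (P X : T -> R) (v t : R) :
  (forall w, 0 <= P w) -> 0 < v -> 0 <= t ->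
  (forall lam, \sum_w P w * expR (lam * X w) <= expR (2 * lam ^+ 2 * v)) ->
  \sum_(w | t < `|X w|) P w <= 2 * expR (- (t ^+ 2 / (8 * v))).
Proof.
(* This choice minimizes [2 * lam ^+ 2 * v - lam * t]. *)
move=> P0 v0 t0 mgf; pose lam := t / (4 * v).
have lam0 : 0 <= lam by rewrite divr_ge0// mulr_ge0// ltW.
have lamN : forall s, \sum_w P w * expR (s * lam * X w - lam * t)
    <= expR (2 * (s * lam) ^+ 2 * v - lam * t).
  move=> s; rewrite expRD; under eq_bigr do rewrite expRD mulrA.
  by rewrite -mulr_suml ler_wpM2r ?expR_ge0.
have E : 2 * lam ^+ 2 * v - lam * t = - (t ^+ 2 / (8 * v)).
  by rewrite /lam; field; rewrite gt_eqF.
have := lamN 1; have := lamN (-1).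
rewrite !mulN1r !mul1r sqrrN E => H1 H2.
(* The indicator of the tail is at most the sum of the two one-sided exponentials; whichever matches
   the sign of [X w] is already at least 1 there. *)
apply: le_trans (_ : _ <= \sum_w (P w * expR (lam * X w - lam * t) +
   P w * expR (- lam * X w - lam * t))) _; last first.
  by rewrite big_split/=; lra.
rewrite big_mkcond; apply: ler_sum => w _.
have A1 := mulr_ge0 (P0 w) (expR_ge0 (lam * X w - lam * t)).
have A2 := mulr_ge0 (P0 w) (expR_ge0 (- lam * X w - lam * t)).
case: ifP => [|_]; last by lra.
have one_le s : 0 <= s -> P w <= P w * expR s.
  by move=> s0; rewrite ler_peMr// -expR0 ler_expR.
case: (ger0P (X w)) => [X0|X0] tX.
  apply: le_trans (one_le (lam * X w - lam * t) _) _; last by lra.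
  by rewrite -mulrBr mulr_ge0//; lra.
apply: le_trans (one_le (- lam * X w - lam * t) _) _; last by lra.
by rewrite mulNr -mulrN -mulrBr mulr_ge0//; lra.
Qed.

End Concentration.

(** * The piecewise linear partition of unity on the integer grid *)

Section Hat.
Context {R : realType}.

Definition ramp (x : R) : R := Num.min 1 (Num.max 0 x).
(** The tent of height 1 supported on [j - 1, j + 1]. As a difference of two consecutive ramps, it
    telescopes when summed over [j]. *)
Definition hat (j : nat) (x : R) : R := ramp (x - j%:R + 1) - ramp (x - j%:R).

Lemma rampE (x : R) : (x <= 0 /\ ramp x = 0) \/ (0 <= x <= 1 /\ ramp x = x) \/
  (1 <= x /\ ramp x = 1).
Proof.
rewrite /ramp; case: (leP 0 x) => x0; last first.
  by left; split; [lra|rewrite min_r//].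
case: (leP 1 x) => x1; first by right; right.
by right; left; split => //; lra.
Qed.

Lemma hat_ge0 j x : 0 <= hat j x.
Proof. by rewrite /hat; have [|[|]] := rampE (x - j%:R); have [|[|]] := rampE (x - j%:R + 1); lra. Qed.

Lemma hat_le1 j x : hat j x <= 1.
Proof. by rewrite /hat; have [|[|]] := rampE (x - j%:R); have [|[|]] := rampE (x - j%:R + 1); lra. Qed.

Lemma hat_eq0 j x : 1 <= `|x - j%:R| -> hat j x = 0.
Proof.
rewrite /hat; case: (ger0P (x - j%:R)) => h0 h1;
by have [|[|]] := rampE (x - j%:R); have [|[|]] := rampE (x - j%:R + 1); lra. Qed.

Lemma sum_ramp m x : 0 <= x -> \sum_(j < m) ramp (x - j%:R) = Num.min x m%:R.
Proof.
move=> x0; elim: m => [|m IH]; first by rewrite big_ord0 min_r.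
rewrite big_ord_recr/= IH -(natr1 m).
by case: (leP x m%:R); case: (leP x (m%:R + 1)); have [|[|]] := rampE (x - m%:R); lra.
Qed.

Lemma sum_hat m x : 0 <= x <= m%:R -> \sum_(j < m.+1) hat j x = 1.
Proof.
move=> /andP[x0 xm].
have -> : \sum_(j < m.+1) hat j x = ramp (x + 1) - ramp (x - m%:R).
  elim: m {xm} => [|m IH]; first by rewrite big_ord_recr big_ord0/= /hat add0r !subr0.
  rewrite big_ord_recr/= IH /hat -(natr1 m).
  by rewrite (_ : x - (m%:R + 1) + 1 = x - m%:R); lra.
by have [|[|]] := rampE (x - m%:R); have [|[|]] := rampE (x + 1); lra.
Qed.

(** Summation by parts turns the weighted sum into a sum of ramps plus a boundary term that vanishes
    for [x <= m]. This identity lets a mean be recovered from a histogram without discretization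
    error. *)
Lemma sum_hat_natr m x : 0 <= x <= m%:R -> \sum_(j < m.+1) j%:R * hat j x = x.
Proof.
move=> /andP[x0 xm].
have -> : \sum_(j < m.+1) j%:R * hat j x =
    \sum_(j < m) ramp (x - j%:R) - m%:R * ramp (x - m%:R).
  elim: m {xm} => [|m IH]; first by rewrite big_ord_recr !big_ord0/= !mul0r subrr addr0.
  rewrite big_ord_recr/= IH [in RHS]big_ord_recr/= /hat -(natr1 m).
  by rewrite (_ : x - (m%:R + 1) + 1 = x - m%:R); [ring|lra].
rewrite sum_ramp// min_l//.
suff -> : ramp (x - m%:R) = 0 by rewrite mulr0 subr0.
by have [|[|]] := rampE (x - m%:R); lra.
Qed.

(** For a, b in [0, 1] one has (a - b)^2 <= a + b, and each family of hats sums to 1. *)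
Lemma sum_hat_sub_sq m x y : 0 <= x <= m%:R -> 0 <= y <= m%:R ->
  \sum_(j < m.+1) (hat j x - hat j y) ^+ 2 <= 2.
Proof.
move=> xm ym; rewrite -[leRHS]/(1 + 1) -{1}(sum_hat _ _ xm) -(sum_hat _ _ ym) -big_split/=.
apply: ler_sum => j _.
have := hat_ge0 j x; have := hat_ge0 j y; have := hat_le1 j x; have := hat_le1 j y.
nra.
Qed.

Lemma ler_sum_sqr (I : finType) (a : I -> R) : (forall i, 0 <= a i) ->
  \sum_i a i ^+ 2 <= (\sum_i a i) ^+ 2.
Proof.
move=> a0; rewrite expr2 mulr_suml; apply: ler_sum => i _.
by rewrite expr2 ler_wpM2l// (bigD1 i)//= lerDl sumr_ge0.
Qed.

(** For y <= x the ramp increments are nonnegative with total at most x - y, so their squares sum to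
    at most (x - y)^2. A hat increment is the difference of two such increments u, v >= 0, and (u -
    v)^2 <= u^2 + v^2. *)
Lemma sum_hat_sub_sq_lip m x y : 0 <= x <= m%:R -> 0 <= y <= m%:R ->
  \sum_(j < m.+1) (hat j x - hat j y) ^+ 2 <= 2 * (x - y) ^+ 2.
Proof.
wlog yx : x y / y <= x => [H xm ym|].
  have [|/ltW] := leP y x => [yx|xy]; first exact: H.
  rewrite (_ : (x - y) ^+ 2 = (y - x) ^+ 2); last by ring.
  by apply: le_trans (H y x xy ym xm); apply: ler_sum => j _; nra.
move=> /andP[x0 xm] /andP[y0 ym].
have ramp_nd a b : a <= b -> ramp a <= ramp b.
  by move=> ab; have [|[|]] := rampE a; have [|[|]] := rampE b; lra.
have le1 : \sum_(j < m.+1) (ramp (x - j%:R) - ramp (y - j%:R)) ^+ 2 <= (x - y) ^+ 2.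
  apply: le_trans (ler_sum_sqr _ _ _) _ => [j|].
    by rewrite subr_ge0 ramp_nd// lerD2r.
  rewrite sumrB !sum_ramp//.
  have mS : m%:R <= m.+1%:R :> R by rewrite ler_nat.
  by rewrite !min_l//; lra.
have le2 : \sum_(j < m.+1) (ramp (x - j%:R + 1) - ramp (y - j%:R + 1)) ^+ 2 <= (x - y) ^+ 2.
  apply: le_trans (ler_sum_sqr _ _ _) _ => [j|].
    by rewrite subr_ge0 ramp_nd// lerD2r lerD2r.
  rewrite sumrB; under eq_bigr do rewrite addrAC.
  under [X in _ - X]eq_bigr do rewrite addrAC.
  rewrite !sum_ramp; [|lra|lra].
  have mS : m.+1%:R = m%:R + 1 :> R by rewrite natr1.
  by rewrite !min_l//; lra.
rewrite mulr_natl mulr2n; apply: (le_trans _ (lerD le1 le2)); rewrite -big_split/=.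
apply: ler_sum => j _; rewrite /hat.
have := @ramp_nd (y - j%:R) (x - j%:R); have := @ramp_nd (y - j%:R + 1) (x - j%:R + 1).
rewrite !lerD2r => /(_ yx) h1 /(_ yx) h2; nra.
Qed.
End Hat.

(** * Sums of products over finite function spaces *)

Section FiniteProducts.
Context {R : realType}.

Lemma sum_prod_ffun (I T : finType) (F : I -> T -> R) :
  \sum_(f : {ffun I -> T}) \prod_i F i (f i) = \prod_i \sum_t F i t.
Proof. by rewrite bigA_distr_bigA. Qed.

Lemma prod_bool_natr (I : finType) (b : pred I) :
  \prod_i (b i)%:R = [forall i, b i]%:R :> R.
Proof.
have [/forallP bT|/forallPn[i /negbTE bi]] := boolP [forall i, b i].
  by rewrite big1 // => i _; rewrite bT.
by rewrite (bigD1 i)//= bi mul0r.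
Qed.

(** Once [g] is absorbed into the factor of index [k], distributivity gives a product of sums in
    which every other factor is 1. *)
Lemma sum_prod_marginal (I T : finType) (q : I -> T -> R) (k : I) (g : T -> R) :
  (forall i, \sum_t q i t = 1) ->
  \sum_(f : {ffun I -> T}) (\prod_i q i (f i)) * g (f k) = \sum_t q k t * g t.
Proof.
move=> q1; pose F i t := q i t * (if i == k then g t else 1).
transitivity (\sum_(f : {ffun I -> T}) \prod_i F i (f i)).
  apply: eq_bigr => f _; rewrite big_split/=; congr (_ * _).
  by rewrite -big_mkcond/= big_pred1_eq.
rewrite sum_prod_ffun (bigD1 k)//= [X in _ * X]big1 ?mulr1 => [|i ik].
  by apply: eq_bigr => t _; rewrite /F eqxx.
by rewrite -[RHS](q1 i); apply: eq_bigr => t _; rewrite /F (negbTE ik) mulr1.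
Qed.

End FiniteProducts.

(* T with the discrete sigma-algebra; [x0] only serves as the canonical point of the type. *)
Definition discrete (T : finType) (x0 : T) : Type := T.

HB.instance Definition _ (T : finType) (x0 : T) := Finite.copy (discrete T x0) T.
HB.instance Definition _ (T : finType) (x0 : T) := isPointed.Build (discrete T x0) x0.
HB.instance Definition _ (T : finType) (x0 : T) :=
  @isMeasurable.Build default_measure_display (discrete T x0)
    discrete_measurable discrete_measurable0
    discrete_measurableC discrete_measurableU.

(** * Local algorithms built from finite message kernels *)

Section FiniteProbability.
Local Open Scope classical_set_scope.
Context {R : realType}.

(** The sigma-algebra on tuples is generated by the coordinates, so a singleton is measurable as a
    finite intersection of coordinate preimages; any set is a finite union of singletons. *)
Lemma discrete_measurable_tuple (T : finType) (x0 : T) n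
  (A : set (n.-tuple (discrete T x0))) : measurable A.
Proof.
have -> : A = \bigcup_(t in A) [set t] by rewrite (bigcup_imset1 A id) image_id.
apply: fin_bigcup_measurable => [|t _]; first exact: (@finite_finset (n.-tuple T)).
have -> : [set t] = \bigcap_(i in [set: 'I_n])
    ((fun u : n.-tuple (discrete T x0) => tnth u i) @^-1` [set tnth t i]).
  apply/seteqP; split => [u -> i //|u h].
  by apply: eq_from_tnth => i; exact: h.
apply: fin_bigcap_measurable => // i _.
by rewrite -[X in measurable X]setTI; exact: measurable_tnth.
Qed.

(** The measure is a finite sum of Dirac masses weighted by [P], along an enumeration of [T]. *)
Lemma finite_probability (T : finType) (x0 : T) (P : T -> R) :
  (forall t, 0 <= P t) -> \sum_t P t = 1 ->
  exists mu : probability (discrete T x0) R,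
    forall A, mu A = (\sum_(t : T | t \in A) P t)%:E.
Proof.
move=> P0 P1.
pose r k : T := nth x0 (enum T) k.
pose m (k : nat) : {measure set (discrete T x0) -> \bar R} :=
  mscale (NngNum (P0 (r k))) (dirac (r k : discrete T x0)).
pose mu := msum m #|T|.
have muE A : mu A = (\sum_(t : T | t \in A) P t)%:E.
  rewrite /mu /msum /= [in RHS]big_mkcond -[in RHS]big_enum/= (big_nth x0) big_mkord -cardE.
  rewrite -sumEFin; apply: eq_bigr => k _.
  rewrite /mscale/= diracE /r -EFinM; congr EFin.
  by case: (_ \in A); rewrite ?mulr1 ?mulr0.
have mu1 : mu setT = 1%E.
  by rewrite muE -P1; congr EFin; apply: eq_bigl => t; exact: mem_set.
pose B := @Measure_isProbability.Build _ (discrete T x0) R mu mu1.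
pose muP : probability (discrete T x0) R := HB.pack mu B.
by exists muP.
Qed.

(* The coin of a node is a table of one message per possible neighbourhood, each drawn from its
   kernel; the randomizer looks up its own neighbourhood. *)
Lemma kernel_local_alg n (M : finType) (m0 : M) (K : {set 'I_n} -> M -> R)
    (dec : {ffun 'I_n -> M} -> R) :
  (forall N m, 0 <= K N m) -> (forall N, \sum_m K N m = 1) ->
  exists A : local_alg R n,
  [/\ local_alg_wf A,
    forall eps delta,
      (forall (E E' : graph n) (B : pred {ffun 'I_n -> M}),
        simple_graph E -> simple_graph E' -> node_neighbors E E' ->
        \sum_(f | B f) \prod_i K (nbhd E i) (f i) <=
        expR eps * (\sum_(f | B f) \prod_i K (nbhd E' i) (f i)) + delta) ->
      LNDP A eps delta &
    forall (E : graph n) (S : set R),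
      Pr A (alg_output A E @^-1` S) =
      (\sum_(f : {ffun 'I_n -> M} | dec f \in S) \prod_i K (nbhd E i) (f i))%:E].
Proof.
move=> K0 K1.
pose C := {ffun {set 'I_n} -> M}.
pose c0 : C := [ffun=> m0].
pose mu (c : C) : R := \prod_N K N (c N).
pose w0 : {ffun 'I_n -> C} := [ffun=> c0].
pose P (w : {ffun 'I_n -> C}) : R := \prod_i mu (w i).
have mu0 c : 0 <= mu c by apply: prodr_ge0.
have mu1 : \sum_c mu c = 1 by rewrite sum_prod_ffun big1.
have P0 w : 0 <= P w by apply: prodr_ge0.
have P1 : \sum_w P w = 1 by rewrite (sum_prod_ffun _ _ (fun=> mu)) big1.
have [pr prE] := finite_probability _ w0 _ P0 P1.
(* The public string lives in [unit]: the algorithm uses private coins only. A sample point is the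
   family of all tables. *)
pose A := @LocalAlg R n _ (discrete _ w0) pr _ unit _ (discrete _ c0) _ (discrete _ m0)
  (fun=> tt) (fun i w => w i) (fun _ N rc => rc.2 N) (fun t => dec [ffun i => tnth t i]).
(* For a fixed graph each node reads one entry of its own table, so the published messages are
   independent with laws [K (nbhd E i)]. *)
have law (E : graph n) (B : pred {ffun 'I_n -> M}) :
    \sum_(w : {ffun 'I_n -> C} | B [ffun i => w i (nbhd E i)]) P w =
    \sum_(f | B f) \prod_i K (nbhd E i) (f i).
  rewrite (partition_big (fun w : {ffun 'I_n -> C} => [ffun i => w i (nbhd E i)]) B)//=.
  apply: eq_bigr => f Bf.
  transitivity (\sum_(w : {ffun 'I_n -> C})
      \prod_i (mu (w i) * (w i (nbhd E i) == f i)%:R)).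
    rewrite big_mkcond; apply: eq_bigr => w _; rewrite big_split/=.
    rewrite prod_bool_natr mulr_natr mulrb.
    have -> : [forall i, w i (nbhd E i) == f i] = ([ffun i => w i (nbhd E i)] == f).
      apply/forallP/eqP => [h|<- i]; last by rewrite ffunE.
      by apply/ffunP => i; rewrite ffunE; apply/eqP.
    by case: eqP => [->|_]; rewrite ?Bf ?andbF.
  rewrite (sum_prod_ffun _ _ (fun i c => mu c * (c (nbhd E i) == f i)%:R)).
  apply: eq_bigr => i _.
  rewrite (sum_prod_marginal _ _ K (nbhd E i) (fun m => (m == f i)%:R))//.
  rewrite (bigD1 (f i))//= eqxx mulr1 big1 ?addr0// => m /negbTE ->.
  by rewrite mulr0.
exists A; split.
- split => //=.
  + move=> i N; apply: (@measurableT_comp _ _ _ _ _ _ (fun c : discrete _ c0 => c N : discrete _ m0)) => //.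
  + by move=> _ Y _; rewrite setTI; exact: discrete_measurable_tuple.
  + move=> B D _ _.
    have marg i : pr ((fun w : discrete _ w0 => w i) @^-1` D i) =
        (\sum_c mu c * (c \in D i)%:R)%:E.
      rewrite prE -(sum_prod_marginal _ _ (fun=> mu) i (fun c => (c \in D i)%:R))//.
      congr EFin; rewrite big_mkcond; apply: eq_bigr => w _.
      rewrite -[_ \in _ @^-1` _]/(w i \in D i).
      by case: (_ \in _); rewrite ?mulr1 ?mulr0.
    (* An event about a [unit]-valued string is either empty or full. *)
    have [Bt|Bt] := pselect (B tt); last first.
      rewrite (_ : (fun=> tt) @^-1` B = set0) ?set0I ?measure0 ?mul0e//.
      by rewrite -subset0 => w.
    rewrite (_ : (fun=> tt) @^-1` B = setT) ?setTI ?probability_setT ?mul1e; last first.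
      by apply/seteqP; split.
    under eq_bigr do rewrite marg.
    rewrite prE -(big_morph EFin (@EFinM R) erefl); congr EFin.
    rewrite -(sum_prod_ffun _ _ (fun i c => mu c * (c \in D i)%:R)).
    rewrite big_mkcond; apply: eq_bigr => w _; rewrite big_split/=.
    rewrite prod_bool_natr mulr_natr mulrb; congr (if _ then _ else _).
    apply/idP/forallP => [/set_mem h i|h]; first exact/mem_set/h.
    by apply/mem_set => i _; exact/set_mem/h.
- move=> eps delta H r E E' sE sE' [v vE] B _.
  have prB (G : graph n) : pr (rand_outputs A r G @^-1` B) =
     (\sum_(f : {ffun 'I_n -> M} | [tuple f i | i < n] \in B) \prod_i K (nbhd G i) (f i))%:E.
    rewrite prE -law; congr EFin; apply: eq_bigl => w.
    have wG : rand_outputs A r G w = [tuple [ffun i => w i (nbhd G i)] i | i < n].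
      by apply: eq_from_tnth => i; rewrite !tnth_mktuple ffunE.
    by rewrite -wG; apply/idP/idP => /set_mem wB; exact/mem_set.
  rewrite /= !prB -!EFinM -!EFinD !lee_fin; split; apply: H => //.
    by exists v.
  by exists v => e ve; rewrite vE.
- move=> E S; rewrite [LHS]/= prE -law; congr EFin; apply: eq_bigl => w.
  have wE : alg_output A E w = dec [ffun i => w i (nbhd E i)].
    rewrite /alg_output/=; congr dec; apply/ffunP => i.
    by rewrite !ffunE tnth_mktuple.
  by rewrite -wE; apply/idP/idP => /set_mem wS; exact/mem_set.
Qed.

End FiniteProbability.

(** * Privacy and concentration of independent random signs *)

Section NoisyBits.
Context {R : realType}.

(* A random bit whose sign [(-1) ^+ ~~ b] has mean x. *)
Definition bit_pmf (x : R) (b : bool) : R := (1 + (-1) ^+ (~~ b) * x) / 2.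

Definition bits_pmf (I J : finType) (x : I -> J -> R) (f : {ffun I -> {ffun J -> bool}}) : R :=
  \prod_i \prod_j bit_pmf (x i j) (f i j).

Lemma sum_bit_pmf x : \sum_b bit_pmf x b = 1.
Proof. by rewrite big_bool /bit_pmf/= expr1 expr0; lra. Qed.

Lemma bit_pmf_ge0 x b : `|x| <= 1 -> 0 <= bit_pmf x b.
Proof. by rewrite ler_norml /bit_pmf; case: b => /=; rewrite ?expr1 ?expr0; lra. Qed.

Lemma bits_pmf_ge0 (I J : finType) (x : I -> J -> R) f :
  (forall i j, `|x i j| <= 1) -> 0 <= bits_pmf _ _ x f.
Proof. by move=> x1; do 2!apply: prodr_ge0 => ? _; exact: bit_pmf_ge0. Qed.

(** The term linear in [lam] bounds the mean log-likelihood ratio through [ln u <= u - 1], a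
    chi-square type bound; the quadratic one comes from [expR_le_addr], the log-ratio being at most
    [2 * |x - y|] in absolute value. *)
Lemma bit_loglikelihood_mgf (x y lam : R) : `|x| <= 1 / 2 -> `|y| <= 1 / 2 -> 0 <= lam ->
  \sum_b bit_pmf x b * expR (lam * ln (bit_pmf x b / bit_pmf y b)) <=
  expR ((2 * lam + 8 * lam ^+ 2) * (x - y) ^+ 2).
Proof.
move=> x2 y2 lam0; set d := x - y.
have bnd b : bit_pmf x b * expR (lam * ln (bit_pmf x b / bit_pmf y b)) <=
    lam * ((bit_pmf x b - bit_pmf y b) + d ^+ 2) + bit_pmf x b * expR (8 * lam ^+ 2 * d ^+ 2).
  have : (bit_pmf x b - bit_pmf y b) ^+ 2 = d ^+ 2 / 4.
    by rewrite /bit_pmf /d; case: b => /=; rewrite ?expr1 ?expr0; field.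
  (* Means of size at most 1/2 keep both masses away from 0, which makes the likelihood ratio
     Lipschitz. *)
  have : 1 / 4 <= bit_pmf x b.
    by move: x2; rewrite ler_norml /bit_pmf; case: b => /=; rewrite ?expr1 ?expr0; lra.
  have : 1 / 4 <= bit_pmf y b.
    by move: y2; rewrite ler_norml /bit_pmf; case: b => /=; rewrite ?expr1 ?expr0; lra.
  move: (bit_pmf x b) (bit_pmf y b) => a c c4 a4 ac.
  have a0 : 0 < a by lra.
  have c0 : 0 < c by lra.
  have lnle u : 0 < u -> ln u <= u - 1.
    by move=> u0; rewrite -{1}(subrKC 1 u); apply: le_ln1Dx; lra.
  have L1 : ln (a / c) <= a / c - 1 by apply: lnle; rewrite divr_gt0.
  have L2 : - ln (a / c) <= c / a - 1.
    by rewrite -lnV ?posrE ?divr_gt0// invf_div; apply: lnle; rewrite divr_gt0.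
  have E1 : a / c - 1 = (a - c) / c by field; rewrite gt_eqF.
  have E2 : c / a - 1 = (c - a) / a by field; rewrite gt_eqF.
  have Lsq : ln (a / c) ^+ 2 <= 4 * d ^+ 2.
    have F1 : a / c - 1 <= 4 * `|a - c|.
      rewrite E1 ler_pdivrMr//; have := ler_norm (a - c); have := normr_ge0 (a - c).
      by move: `|_| => s; nra.
    have F2 : c / a - 1 <= 4 * `|a - c|.
      rewrite E2 ler_pdivrMr//; have := ler_norm (c - a); rewrite distrC.
      by have := normr_ge0 (a - c); move: `|_| => s; nra.
    have : `|ln (a / c)| <= 4 * `|a - c| by rewrite ler_norml; lra.
    rewrite -(ler_pXn2r (n := 2))// ?nnegrE ?mulr_ge0// real_normK ?num_real//.
    by rewrite exprMn real_normK ?num_real// ac; lra.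
  apply: (@le_trans _ _ (a * (lam * (a / c - 1) + expR (8 * lam ^+ 2 * d ^+ 2)))).
    rewrite ler_wpM2l ?(ltW a0)//; apply: (le_trans (expR_le_addr _)).
    apply: lerD; first by rewrite ler_wpM2l.
    by rewrite ler_expR exprMn; have := sqr_ge0 lam; nra.
  (* Here a (a - c) / c = (a - c) + (a - c)^2 / c, with (a - c)^2 = d^2 / 4 and c >= 1/4. *)
  rewrite mulrDr lerD2r mulrCA ler_wpM2l// E1 mulrA ler_pdivrMr//; nra.
(* Summed over the two values of the bit, the differences of masses cancel. *)
rewrite big_bool; apply: le_trans (lerD (bnd true) (bnd false)) _.
have s1 := sum_bit_pmf x; have s2 := sum_bit_pmf y; rewrite !big_bool/= in s1 s2.
rewrite [X in _ <= expR X]mulrDl expRD addrACA -mulrDr -mulrDl s1 mul1r.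
rewrite (_ : _ + _ + (_ + _) = 2 * d ^+ 2); last by lra.
have := expR_ge1Dx (2 * lam * d ^+ 2).
have : 1 <= expR (8 * lam ^+ 2 * d ^+ 2).
  by rewrite -[X in X <= _]expR0 ler_expR; have := mulr_ge0 (sqr_ge0 lam) (sqr_ge0 d); lra.
have := mulr_ge0 lam0 (sqr_ge0 d).
by move: (expR _) (expR _) => e1 e2; nra.
Qed.

(* With lam = 2 l / eps, Markov bounds the P-mass of [L > eps] by exp(-l). *)
Lemma indist_of_loglikelihood_mgf (T : finType) (P Q L : T -> R) (B : pred T) (D eps l : R) :
  (forall w, 0 <= Q w) -> (forall w, P w = Q w * expR (L w)) ->
  0 < eps <= 1 -> 1 / 2 <= l -> D <= eps ^+ 2 / (64 * l) ->
  (forall lam, 0 <= lam ->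
     \sum_w P w * expR (lam * L w) <= expR ((2 * lam + 8 * lam ^+ 2) * D)) ->
  \sum_(w | B w) P w <= expR eps * (\sum_(w | B w) Q w) + expR (- l).
Proof.
move=> Q0 PQ /andP[e0 e1] l2 Dle mgf.
have l0 : 0 < l by lra.
pose lam := 2 * l / eps.
have lam0 : 0 <= lam by rewrite divr_ge0 ?mulr_ge0// ltW.
have tail : \sum_w P w * expR (lam * L w - lam * eps) <= expR (- l).
  under eq_bigr do rewrite expRD mulrA.
  rewrite -mulr_suml; apply: (@le_trans _ _ (expR ((2 * lam + 8 * lam ^+ 2) * D) * expR (- (lam * eps)))).
    by rewrite ler_wpM2r ?expR_ge0// mgf.
  rewrite -expRD ler_expR.
  have -> : lam * eps = 2 * l by rewrite /lam; field; rewrite gt_eqF.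
  (* The exponent becomes eps / 16 + l / 2 - 2 l, which is at most - l because eps <= 1 <= 2 l. *)
  have : (2 * lam + 8 * lam ^+ 2) * D <= (2 * lam + 8 * lam ^+ 2) * (eps ^+ 2 / (64 * l)).
    by rewrite ler_wpM2l// addr_ge0// mulr_ge0// sqr_ge0.
  have -> : (2 * lam + 8 * lam ^+ 2) * (eps ^+ 2 / (64 * l)) = eps / 16 + l / 2.
    by rewrite /lam; field; rewrite !gt_eqF.
  by lra.
apply: le_trans (lerD (lexx _) tail).
apply: (@le_trans _ _ (\sum_(w | B w) (expR eps * Q w + P w * expR (lam * L w - lam * eps)))).
  (* Where [L w <= eps] the likelihood ratio is at most [expR eps]; elsewhere the exponential weight
     is at least 1. *)
  apply: ler_sum => w _; have P0 : 0 <= P w by rewrite PQ mulr_ge0// expR_ge0.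
  have [Le|/ltW eL] := leP (L w) eps.
    apply: (@le_trans _ _ (expR eps * Q w)).
      by rewrite PQ mulrC ler_wpM2r// ler_expR.
    by rewrite lerDl mulr_ge0// expR_ge0.
  apply: (@le_trans _ _ (P w * expR (lam * L w - lam * eps))).
    by rewrite ler_peMr// -expR0 ler_expR -mulrBr mulr_ge0// subr_ge0.
  by rewrite lerDr mulr_ge0// expR_ge0.
rewrite big_split/= -mulr_sumr lerD2l [leRHS](bigID B)/= lerDl sumr_ge0// => w _.
by rewrite PQ !mulr_ge0// expR_ge0.
Qed.

(** The log-likelihood ratio is a sum over independent bits, so its exponential moment factorizes
    and the squared changes of the means add up. *)
Lemma bits_pmf_indist (I J : finType) (x y : I -> J -> R)
    (B : pred {ffun I -> {ffun J -> bool}}) (eps l : R) :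
  (forall i j, `|x i j| <= 1 / 2) -> (forall i j, `|y i j| <= 1 / 2) ->
  0 < eps <= 1 -> 1 / 2 <= l ->
  \sum_i \sum_j (x i j - y i j) ^+ 2 <= eps ^+ 2 / (64 * l) ->
  \sum_(f | B f) bits_pmf _ _ x f <=
    expR eps * (\sum_(f | B f) bits_pmf _ _ y f) + expR (- l).
Proof.
move=> x2 y2 e01 l2 D.
pose r i j b := ln (bit_pmf (x i j) b / bit_pmf (y i j) b).
have pos z b : `|z| <= 1 / 2 -> 0 < bit_pmf z b.
  by rewrite ler_norml /bit_pmf; case: b => /=; rewrite ?expr1 ?expr0; lra.
apply: (indist_of_loglikelihood_mgf _ _ (bits_pmf _ _ y)
  (fun f : {ffun I -> {ffun J -> bool}} => \sum_i \sum_j r i j (f i j)) _ _ _ _ _ _ e01 l2 D).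
- move=> f; apply: bits_pmf_ge0 => i j; apply: le_trans (y2 i j) _; lra.
- move=> f; rewrite expR_sum -big_split/=; apply: eq_bigr => i _.
  rewrite expR_sum -big_split/=; apply: eq_bigr => j _.
  have xij := pos _ (f i j) (x2 i j); have yij := pos _ (f i j) (y2 i j).
  by rewrite lnK ?posrE; [rewrite mulrCA divff ?mulr1// gt_eqF|exact: divr_gt0].
- move=> lam lam0.
  have -> : \sum_f bits_pmf _ _ x f * expR (lam * \sum_i \sum_j r i j (f i j)) =
      \prod_i \prod_j \sum_b bit_pmf (x i j) b * expR (lam * r i j b).
    under [RHS]eq_bigr do rewrite -sum_prod_ffun.
    rewrite -sum_prod_ffun; apply: eq_bigr => f _.
    rewrite mulr_sumr expR_sum -big_split/=; apply: eq_bigr => i _.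
    by rewrite mulr_sumr expR_sum -big_split.
  rewrite mulr_sumr expR_sum; apply: ler_prod => i _; apply/andP; split.
    apply: prodr_ge0 => j _; apply: sumr_ge0 => b _.
    by rewrite mulr_ge0 ?expR_ge0// ltW// pos.
  rewrite mulr_sumr expR_sum; apply: ler_prod => j _; apply/andP; split.
    by apply: sumr_ge0 => b _; rewrite mulr_ge0 ?expR_ge0// ltW// pos.
  exact: bit_loglikelihood_mgf.
Qed.

Lemma sum_bits_pmf (I J : finType) (x : I -> J -> R) : \sum_f bits_pmf _ _ x f = 1.
Proof.
rewrite (sum_prod_ffun _ _ (fun i (m : {ffun J -> bool}) => \prod_j bit_pmf (x i j) (m j))).
rewrite big1// => i _; rewrite (sum_prod_ffun _ _ (fun j => bit_pmf (x i j))) big1// => j _.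
exact: sum_bit_pmf.
Qed.

(** The other columns integrate out. A centred sign has absolute value at most 2, hence the variance
    proxy [4 * #|I|]. *)
Lemma bits_pmf_tail (I J : finType) (x : I -> J -> R) (j : J) (t : R) :
  (0 < #|I|)%N -> (forall i k, `|x i k| <= 1) -> 0 <= t ->
  \sum_(f : {ffun I -> {ffun J -> bool}}
       | t < `|\sum_i ((-1) ^+ (~~ f i j) - x i j)|) bits_pmf _ _ x f
    <= 2 * expR (- (t ^+ 2 / (32 * #|I|%:R))).
Proof.
move=> I0 x1 t0; rewrite (_ : 32 * #|I|%:R = 8 * (4 * #|I|%:R)); last by lra.
apply: (@chernoff _ _ _ (fun f : {ffun I -> {ffun J -> bool}} => \sum_i ((-1) ^+ (~~ f i j) - x i j))) => //.
- by move=> f; exact: bits_pmf_ge0.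
- by rewrite mulr_gt0// ltr0n.
move=> lam.
pose g i (b : bool) := (-1) ^+ (~~ b) - x i j.
have -> : \sum_f bits_pmf _ _ x f * expR (lam * \sum_i g i (f i j)) =
    \prod_i \sum_b bit_pmf (x i j) b * expR (lam * g i b).
  under [RHS]eq_bigr => i _ do
    rewrite -(@sum_prod_marginal _ _ _ (fun j => bit_pmf (x i j)) j
      (fun b => expR (lam * g i b)) (fun k => sum_bit_pmf (x i k))).
  rewrite -sum_prod_ffun; apply: eq_bigr => f _.
  by rewrite mulr_sumr expR_sum -big_split.
have -> : expR (2 * lam ^+ 2 * (4 * #|I|%:R)) = \prod_(i : I) expR (2 * lam ^+ 2 * 4).
  by rewrite prodr_const -expRM_natr; congr expR; rewrite mulrA.
apply: ler_prod => i _; apply/andP; split.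
  by apply: sumr_ge0 => b _; rewrite mulr_ge0 ?expR_ge0// bit_pmf_ge0.
apply: subgaussian_mgf.
- by move=> b; exact: bit_pmf_ge0.
- exact: sum_bit_pmf.
- by rewrite big_bool /bit_pmf /g/= expr1 expr0; field.
- have := x1 i j; rewrite ler_norml /g => /andP[? ?] [] /=; rewrite ?expr0 ?expr1; nra.
Qed.

End NoisyBits.

(** * Reading the mean of a concentrated histogram off its noisy peak *)

Section PeakDecoding.
Context {R : realType}.

(** All such indices lie within 2 r of any one of them, [j0], hence in a window of length 4 r;
    truncation of [j0 - 2 * r] at 0 only shifts that window right. *)
Lemma card_near (m r : nat) (a : R) : (#|[pred j : 'I_m | (`|j%:R - a| < r%:R)%R]| <= 4 * r)%N.
Proof.
have [j0 j0a|no] := pickP [pred j : 'I_m | `|j%:R - a| < r%:R]; last by rewrite eq_card0.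
rewrite cardE -(size_map val) -[leqRHS](size_iota (j0 - 2 * r)).
apply: uniq_leq_size; first by rewrite map_inj_uniq ?enum_uniq//; exact: val_inj.
move=> _ /mapP[j jin ->]; move: jin j0a; rewrite mem_enum !inE mem_iota/= !ltr_norml.
move=> /andP[j1 j2] /andP[k1 k2].
have : (j < j0 + 2 * r)%N by rewrite -(ltr_nat R) natrD natrM; lra.
have : (j0 < j + 2 * r)%N by rewrite -(ltr_nat R) natrD natrM; lra.
lia.
Qed.

Lemma sum_near_le (m r : nat) (a c : R) : 0 <= c ->
  \sum_(j : 'I_m | `|j%:R - a| < r%:R) c <= (4 * r)%:R * c.
Proof.
move=> c0; rewrite sumr_const -[leLHS]mulr_natl ler_wpM2r// ler_nat.
exact: card_near.
Qed.

Context (m : nat).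

Definition peak (Y : 'I_m.+1 -> R) : 'I_m.+1 := [arg max_(j > ord0) Y j]%O.

(** Centring at the peak keeps the weights on the noise below 4, whatever the position of the
    peak. *)
Definition peak_mean (Y : 'I_m.+1 -> R) : R :=
  (peak Y)%:R + \sum_(j : 'I_m.+1 | `|j%:R - (peak Y)%:R| < 4 :> R) (j%:R - (peak Y)%:R) * Y j.

Lemma peak_mean_error (h Y : 'I_m.+1 -> R) (x0 s : R) :
  (forall j, 0 <= h j) -> \sum_j h j = 1 ->
  (forall j : 'I_m.+1, 2 <= `|j%:R - x0| -> h j = 0) ->
  (forall j, `|Y j - h j| <= 1 / 32) ->
  (forall j : 'I_m.+1, `|j%:R - x0| < 6 -> `|Y j - h j| <= s) ->
  `|peak_mean Y - \sum_(j < m.+1) j%:R * h j| <= 64 * s.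
Proof.
move=> h0 h1 hx0 Yh Ys.
set k := peak Y.
have Yk j : Y j <= Y k by rewrite /k /peak; case: arg_maxP => // i _; exact.
(* Pigeonhole: the unit mass of [h] sits on at most 8 indices. *)
have [j0 hj0] : exists j, 1 / 8 <= h j.
  apply: contrapT => /forallNP small; have : \sum_j h j < 1; last by rewrite h1 ltxx.
  have hlt j : h j < 1 / 8 by rewrite ltNge; apply/negP/small.
  apply: le_lt_trans (_ : _ <= \sum_(j : 'I_m.+1 | `|j%:R - x0| < 2) h j) _.
    by rewrite (bigID (fun j : 'I_m.+1 => `|j%:R - x0| < 2))/= [X in _ + X]big1 ?addr0// => j;
      rewrite -leNgt; exact: hx0.
  have [j1 j1x|no] := pickP (fun j : 'I_m.+1 => `|j%:R - x0| < 2); last by rewrite big_pred0.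
  apply: (@lt_le_trans _ _ (\sum_(j : 'I_m.+1 | `|j%:R - x0| < 2) 1 / 8)).
    by apply: ltr_sum => //; apply/hasP; exists j1; rewrite ?mem_index_enum.
  by apply: le_trans (sum_near_le _ 2 _ _ _) _; lra.
(* Outside the support [Y] is at most 1/32, while [Y j0 >= 1/8 - 1/32]. So the window of radius 4
   around [k] covers the support of [h] and stays within 6 of [x0]. *)
have kx : `|k%:R - x0| < 2.
  rewrite ltNge; apply/negP => /hx0 hk.
  have := Yk j0; have := Yh j0; have := Yh k; rewrite hk !ler_norml; lra.
have s0 : 0 <= s by apply: le_trans (Ys k _); [exact: normr_ge0|lra].
have -> : \sum_(j < m.+1) j%:R * h j =
    k%:R + \sum_(j : 'I_m.+1 | `|j%:R - k%:R| < 4 :> R) (j%:R - k%:R) * h j.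
  have -> : \sum_(j < m.+1) j%:R * h j = k%:R + \sum_(j < m.+1) (j%:R - k%:R) * h j.
    under [X in _ = _ + X]eq_bigr do rewrite mulrBl.
    by rewrite sumrB -mulr_sumr h1 mulr1 addrC subrK.
  congr (_ + _); rewrite [LHS](bigID (fun j : 'I_m.+1 => `|j%:R - k%:R| < 4 :> R))/=.
  rewrite [X in _ + X]big1 ?addr0// => j; rewrite -leNgt => jk.
  rewrite hx0 ?mulr0//; move: jk.
  have := ler_distD x0 j%:R k%:R; rewrite (distrC x0); lra.
rewrite /peak_mean -/k opprD addrACA subrr add0r -sumrB.
apply: (le_trans (ler_norm_sum _ _ _)).
(* At most 16 indices, each contributing at most 4 s: this is the factor 64. *)
apply: (@le_trans _ _ (\sum_(j : 'I_m.+1 | `|j%:R - k%:R| < 4 :> R) 4 * s)).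
  apply: ler_sum => j jk; rewrite -mulrBr normrM; apply: ler_pM => //; first exact: ltW.
  by apply: Ys; have := ler_distD k%:R j%:R x0; lra.
by apply: le_trans (sum_near_le _ 4 _ _ _) _; [lra|rewrite natrM; lra].
Qed.

End PeakDecoding.

(** * Degrees and edge counts in G(n,p) *)

Section RandomGraph.
Context {R : realType}.
Variables (n : nat) (p : R).
Hypothesis p01 : 0 <= p <= 1.

Definition pairs : {set {set 'I_n}} := [set e : {set 'I_n} | #|e| == 2%N].
Definition star (i : 'I_n) : {set {set 'I_n}} := [set e in pairs | i \in e].
Definition edge_dev (A : {set {set 'I_n}}) (E : graph n) : R :=
  \sum_(e in A) ((e \in E)%:R - p).

Lemma gnp_weight_ge0 (E : graph n) : 0 <= gnp_weight p E.
Proof. by have [p0 p1] := andP p01; apply: prodr_ge0 => e _; case: ifP => _; lra. Qed.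

(** Independence of the edges: expanding the right-hand product chooses the set of edges that are
    present. *)
Lemma sum_gnp_weight_prod (g : {set 'I_n} -> bool -> R) :
  \sum_(E : graph n | simple_graph E) gnp_weight p E * \prod_(e in pairs) g e (e \in E) =
  \prod_(e in pairs) (p * g e true + (1 - p) * g e false).
Proof.
(* Outside [pairs] the weights (0, 1) kill every non-simple E. *)
pose F e := if e \in pairs then p * g e true else 0.
pose G e := if e \in pairs then (1 - p) * g e false else 1.
transitivity (\prod_e (F e + G e)); last first.
  rewrite [RHS]big_mkcond; apply: eq_bigr => e _.
  by rewrite /F /G; case: ifP => _; rewrite ?add0r.
rewrite bigA_distr big_mkcond; apply: eq_bigr => E _.
have -> : gnp_weight p E = \prod_(e in pairs) (if e \in E then p else 1 - p).
  by apply: eq_bigl => e; rewrite inE.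
case: ifPn => [/forall_inP sE|].
  rewrite -big_split [LHS]big_mkcond; apply: eq_bigr => e _; rewrite /F /G.
  case: (boolP (e \in E)) => [/sE e2|_]; first by rewrite inE e2.
  by case: ifP.
rewrite negb_forall => /existsP[e]; rewrite negb_imply => /andP[eE e2].
by rewrite (bigD1 e)//= eE /F inE (negbTE e2) mul0r.
Qed.

Lemma sum_gnp_weight : \sum_(E : graph n | simple_graph E) gnp_weight p E = 1.
Proof.
transitivity (\prod_(e in pairs) (p * 1 + (1 - p) * 1)).
  rewrite -(sum_gnp_weight_prod (fun _ _ => 1)).
  by apply: eq_bigr => E _; rewrite big1 ?mulr1.
by rewrite big1// => e _; lra.
Qed.

(** Centred edge indicators are bounded by 1 and independent, so their exponential moments multiply;
    [v] leaves room for a round bound on the number of pairs. *)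
Lemma gnp_tail (A : {set {set 'I_n}}) (v t : R) :
  A \subset pairs -> #|A|%:R <= v -> 0 < v -> 0 <= t ->
  \sum_(E : graph n | simple_graph E && (t < `|edge_dev A E|)) gnp_weight p E <=
  2 * expR (- (t ^+ 2 / (8 * v))).
Proof.
have [p0 p1] := andP p01.
move=> /fintype.subsetP Ap Av v0 t0.
have ApE e : (e \in pairs) && (e \in A) = (e \in A) by apply: andb_idl; exact: Ap.
pose P (E : graph n) := if simple_graph E then gnp_weight p E else 0.
have P0 E : 0 <= P E by rewrite /P; case: ifP => // _; exact: gnp_weight_ge0.
rewrite (_ : \sum_(E | _) _ = \sum_(E | t < `|edge_dev A E|) P E); last first.
  by rewrite [RHS]big_mkcond [LHS]big_mkcond; apply: eq_bigr => E _; rewrite /P; case: (simple_graph E); case: (t < _).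
apply: chernoff => // lam.
pose g e (b : bool) := if e \in A then expR (lam * (b%:R - p)) else 1.
have -> : \sum_w P w * expR (lam * edge_dev A w) =
    \prod_(e in pairs) (p * g e true + (1 - p) * g e false).
  rewrite -sum_gnp_weight_prod [RHS]big_mkcond; apply: eq_bigr => E _.
  rewrite /P; case: ifP => _; last by rewrite mul0r.
  congr (_ * _); rewrite /edge_dev mulr_sumr expR_sum /g -big_mkcondr/=.
  by apply: eq_bigl => e; rewrite ApE.
apply: (@le_trans _ _ (\prod_(e in A) expR (2 * lam ^+ 2))).
  rewrite -(eq_bigl _ _ ApE) big_mkcondr/=; apply: ler_prod => e _; rewrite /g.
  case: ifP => _; last by apply/andP; split; lra.
  apply/andP; split; first by rewrite addr_ge0// mulr_ge0 ?expR_ge0//; lra.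
  have := @subgaussian_mgf R bool (fun b => if b then p else 1 - p) (fun b => b%:R - p) 1 lam.
  rewrite !big_bool/= mulr1; apply.
  - by case; lra.
  - lra.
  - lra.
  - by case=> /=; nra.
rewrite prodr_const -expRM_natr ler_expR ler_wpM2l//.
by rewrite mulr_ge0// sqr_ge0.
Qed.

Lemma star_imset (i : 'I_n) : star i = [set [set i; j] | j in [set~ i]].
Proof.
apply/setP => e; rewrite !inE; apply/andP/imsetP => [[/cards2P[x [y [xy ->]]]]|[j]].
  rewrite !inE => /orP[/eqP->|/eqP->]; first by exists y => //; rewrite !inE eq_sym.
  by exists x; rewrite ?inE// finset.setUC.
by rewrite !inE => ji ->; rewrite cards2 (eq_sym i) ji !inE eqxx.
Qed.

Lemma sum_star (i : 'I_n) (F : {set 'I_n} -> R) :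
  \sum_(e in star i) F e = \sum_(j | j != i) F [set i; j].
Proof.
rewrite star_imset big_imset/=; last first.
  move=> j k; rewrite !inE => ji ki /setP/(_ j).
  by rewrite !inE eqxx orbT (negbTE ji)/= => /esym/eqP.
by apply: eq_bigl => j; rewrite !inE.
Qed.

Lemma card_star (i : 'I_n) : #|star i| = n.-1.
Proof.
rewrite star_imset card_in_imset; last first.
  move=> j k; rewrite !inE => ji ki /setP/(_ j).
  by rewrite !inE eqxx orbT (negbTE ji)/= => /esym/eqP.
by rewrite cardsC1 card_ord.
Qed.

Lemma card_nbhd (E : graph n) (i : 'I_n) : simple_graph E ->
  #|nbhd E i|%:R = \sum_(e in star i) (e \in E)%:R :> R.
Proof.
move=> /forall_inP sE; rewrite sum_star -sum1_card natr_sum.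
rewrite [LHS]big_mkcond [RHS]big_mkcond; apply: eq_bigr => j _; rewrite inE.
case: (altP (j =P i)) => [->|ji] /=; last by case: ifP.
by case: ifP => // /sE; rewrite finset.setUid cards1.
Qed.

Lemma edge_dev_star (E : graph n) (i : 'I_n) : simple_graph E ->
  edge_dev (star i) E = #|nbhd E i|%:R - p * n.-1%:R.
Proof. by move=> sE; rewrite /edge_dev sumrB -card_nbhd// sumr_const card_star mulr_natr. Qed.

(** Handshake: each pair belongs to the stars of its two endpoints. *)
Lemma sum_edge_dev_star (E : graph n) :
  \sum_i edge_dev (star i) E = 2 * edge_dev pairs E.
Proof.
rewrite /edge_dev mulr_sumr (exchange_big_dep (fun e => e \in pairs))/=; last first.
  by move=> i e _; rewrite inE => /andP[].
apply: eq_bigr => e; rewrite inE => e2.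
rewrite sumr_const mulr_natl; congr (_ *+ _); rewrite -(eqP e2).
by apply: eq_card => i; rewrite -[LHS]/(e \in star i) !inE e2.
Qed.

End RandomGraph.

(** * The density estimator, its sensitivity and its deterministic error *)

Section Estimator.
Context {R : realType} (n : nat).
Implicit Types (w alpha : R) (E : graph n).

(** The means of the published signs. The bins 0, ..., n suffice because a degree divided by
    [w >= 1] is at most n. *)
Definition signal w alpha (N : {set 'I_n}) (j : 'I_n.+1) : R :=
  alpha * hat j (#|N|%:R / w).

(** The normalization makes this an unbiased estimate of the average of [hat j] over the nodes. *)
Definition score alpha (f : {ffun 'I_n -> {ffun 'I_n.+1 -> bool}}) (j : 'I_n.+1) : R :=
  (\sum_i (-1) ^+ (~~ f i j)) / (n%:R * alpha).

Definition density_estimate w alpha (f : {ffun 'I_n -> {ffun 'I_n.+1 -> bool}}) : R :=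
  w / n.-1%:R * peak_mean _ (score alpha f).

(** Pairs avoiding [v] are unchanged, so only the membership of [v] in the neighbourhood can
    differ. *)
Lemma card_nbhd_neighbors E E' (v i : 'I_n) :
  (forall e : {set 'I_n}, v \notin e -> (e \in E) = (e \in E')) -> i != v ->
  `|#|nbhd E i|%:R - #|nbhd E' i|%:R| <= 1 :> R.
Proof.
move=> EE' iv; rewrite (cardsD1 v) (cardsD1 v (nbhd E' i)).
rewrite (_ : nbhd E' i :\ v = nbhd E i :\ v); last first.
  apply/setP => j; rewrite !inE; case: eqP => //= /eqP jv.
  by rewrite EE'// !inE negb_or eq_sym iv eq_sym.
rewrite !natrD ler_norml; case: (_ \in _); case: (_ \in _) => /=; lra.
Qed.

Lemma degree_ratio w (N : {set 'I_n}) : 1 <= w -> 0 <= #|N|%:R / w <= n%:R.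
Proof.
move=> w1; have w0 : 0 < w by lra.
rewrite divr_ge0 ?ler0n ?(ltW w0)//= ler_pdivrMr//.
have : #|N|%:R <= n%:R :> R by rewrite ler_nat -[leqRHS]card_ord max_card.
by have := ler0n R n; nra.
Qed.

(** The rewired node contributes at most 2 alpha^2. Each other node contributes at most 2 alpha^2 /
    w^2, which over n nodes is at most alpha^2. *)
Lemma signal_sensitivity w alpha E E' : 1 <= w -> 2 * n%:R <= w ^+ 2 ->
  node_neighbors E E' ->
  \sum_i \sum_j (signal w alpha (nbhd E i) j - signal w alpha (nbhd E' i) j) ^+ 2
    <= 3 * alpha ^+ 2.
Proof.
move=> w1 wn [v EE']; have w0 : 0 < w by lra.
have scale i : \sum_j (signal w alpha (nbhd E i) j - signal w alpha (nbhd E' i) j) ^+ 2 =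
    alpha ^+ 2 * \sum_(j < n.+1) (hat j (#|nbhd E i|%:R / w) - hat j (#|nbhd E' i|%:R / w)) ^+ 2.
  by rewrite mulr_sumr; apply: eq_bigr => j _; rewrite /signal -mulrBr exprMn.
rewrite (bigD1 v)//= scale.
have a2 := sqr_ge0 alpha.
have lev := sum_hat_sub_sq _ _ _ (degree_ratio _ (nbhd E v) w1) (degree_ratio _ (nbhd E' v) w1).
have others : \sum_(i | i != v) \sum_j
    (signal w alpha (nbhd E i) j - signal w alpha (nbhd E' i) j) ^+ 2
    <= \sum_(i : 'I_n) alpha ^+ 2 * (2 / w ^+ 2).
  rewrite [leRHS](bigID (fun i => i != v))/=.
  rewrite -[leLHS]addr0 lerD ?sumr_ge0//; last first.
    by move=> i _; rewrite mulr_ge0// divr_ge0// sqr_ge0.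
  apply: ler_sum => i iv; rewrite scale ler_wpM2l//.
  apply: le_trans (sum_hat_sub_sq_lip _ _ _ (degree_ratio _ _ w1) (degree_ratio _ _ w1)) _.
  rewrite ler_wpM2l// -mulrBl expr_div_n -[leRHS]div1r ler_wpM2r ?invr_ge0 ?sqr_ge0//.
  by rewrite -(@real_normK _ (_ - _)) ?num_real// expr_le1// (card_nbhd_neighbors _ _ v).
move: others; rewrite sumr_const card_ord -mulr_natr => others.
have : alpha ^+ 2 * (2 / w ^+ 2) * n%:R <= alpha ^+ 2.
  rewrite -mulrA -[leRHS]mulr1 ler_wpM2l// mulrAC ler_pdivrMr ?exprn_gt0//; lra.
nra.
Qed.

Lemma score_error alpha (f : {ffun 'I_n -> {ffun 'I_n.+1 -> bool}}) (x : 'I_n -> R) j (t : R) :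
  0 < alpha -> (0 < n)%N ->
  `|\sum_i ((-1) ^+ (~~ f i j) - alpha * hat j (x i))| <= t ->
  `|score alpha f j - (\sum_i hat j (x i)) / n%:R| <= t / (n%:R * alpha).
Proof.
move=> a0 n0; have nR : 0 < n%:R :> R by rewrite ltr0n.
have na : 0 < n%:R * alpha by rewrite mulr_gt0.
rewrite sumrB -mulr_sumr /score.
have -> : (\sum_i hat j (x i)) / n%:R = (alpha * \sum_i hat j (x i)) / (n%:R * alpha).
  by field; rewrite !gt_eqF.
by rewrite -mulrBl normrM (gtr0_norm (_ : 0 < _^-1)) ?invr_gt0// ler_pM2r// invr_gt0.
Qed.

(** The first error term is the privacy noise in reading the mean degree, the second the sampling
    error of the mean degree itself. *)
Lemma density_estimate_error w alpha E (p s : R)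
    (f : {ffun 'I_n -> {ffun 'I_n.+1 -> bool}}) :
  0 <= p <= 1 -> (1 < n)%N -> 1 <= w -> 0 < alpha -> simple_graph E ->
  (forall i, `|edge_dev n p (star n i) E| <= w) ->
  (forall j, `|\sum_i ((-1) ^+ (~~ f i j) - signal w alpha (nbhd E i) j)| <= n%:R * alpha / 32) ->
  (forall j : 'I_n.+1, `|j%:R - p * n.-1%:R / w| < 6 ->
     `|\sum_i ((-1) ^+ (~~ f i j) - signal w alpha (nbhd E i) j)| <= s) ->
  `|density_estimate w alpha f - p| <=
    w * (64 * (s / (n%:R * alpha))) / n.-1%:R + 2 * `|edge_dev n p (pairs n) E| / (n%:R * n.-1%:R).
Proof.
move=> p01 n1 w1 a0 sE devE far near.
have w0 : 0 < w by lra.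
have n0 : (0 < n)%N by lia.
have nR : 0 < n%:R :> R by rewrite ltr0n.
have n'R : 0 < n.-1%:R :> R by rewrite ltr0n; lia.
pose x i : R := #|nbhd E i|%:R / w.
have x01 i : 0 <= x i <= n%:R := degree_ratio _ _ w1.
pose h (j : 'I_n.+1) := (\sum_i hat j (x i)) / n%:R.
have mean : \sum_(j < n.+1) j%:R * h j = (\sum_i x i) / n%:R.
  rewrite /h; under eq_bigr do rewrite mulrA mulr_sumr.
  rewrite -mulr_suml exchange_big/=; congr (_ / _); apply: eq_bigr => i _.
  exact: sum_hat_natr.
have err : `|peak_mean _ (score alpha f) - \sum_(j < n.+1) j%:R * h j| <= 64 * (s / (n%:R * alpha)).
  apply: (peak_mean_error _ _ _ (p * n.-1%:R / w)).
  - by move=> j; rewrite divr_ge0 ?ler0n// sumr_ge0// => i _; exact: hat_ge0.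
  - rewrite -mulr_suml exchange_big/= (eq_bigr (fun=> 1)) => [|i _]; last exact: sum_hat.
    by rewrite sumr_const card_ord divff// gt_eqF.
  (* Every rescaled degree is within 1 of the centre, so a bin at distance 2 or more is at least 1
     away from all of them. *)
  - move=> j jx; rewrite /h big1 ?mul0r// => i _; apply: hat_eq0.
    have : `|x i - p * n.-1%:R / w| <= 1.
      rewrite /x -mulrBl -edge_dev_star// normrM (gtr0_norm (_ : 0 < w^-1)) ?invr_gt0//.
      by rewrite ler_pdivrMr// mul1r.
    have := ler_distD (x i) j%:R (p * n.-1%:R / w); rewrite (distrC j%:R (x i)); lra.
  - move=> j; have := score_error _ _ x _ _ a0 n0 (far j).
    by rewrite (_ : n%:R * alpha / 32 / _ = 1 / 32)//; field; rewrite !gt_eqF.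
  - by move=> j jx; apply: score_error => //; exact: near.
have -> : density_estimate w alpha f - p =
    w / n.-1%:R * (peak_mean _ (score alpha f) - \sum_(j < n.+1) j%:R * h j) +
    2 * edge_dev n p (pairs n) E / (n%:R * n.-1%:R).
  rewrite -sum_edge_dev_star mean /density_estimate.
  under [X in _ + X / _]eq_bigr do rewrite edge_dev_star//.
  rewrite sumrB sumr_const card_ord -mulr_natr /x -mulr_suml.
  by field; rewrite !gt_eqF.
apply: (le_trans (ler_normD _ _)); apply: lerD.
  rewrite normrM gtr0_norm ?divr_gt0// mulrAC ler_wpM2r ?invr_ge0 ?(ltW n'R)//.
  by rewrite ler_wpM2l// ltW.
by rewrite normrM normrM (gtr0_norm (_ : 0 < _^-1)) ?invr_gt0 ?mulr_gt0// gtr0_norm.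
Qed.

End Estimator.

(** * Probabilities of the good events and numerical constants *)

Section Accuracy.
Context {R : realType}.

Lemma union_bound (T K : finType) (P : T -> R) (S : pred K) (bad : K -> pred T) :
  (forall t, 0 <= P t) ->
  \sum_(t | [exists k, S k && bad k t]) P t <= \sum_(k | S k) \sum_(t | bad k t) P t.
Proof.
move=> P0; under [leRHS]eq_bigr do rewrite big_mkcond.
rewrite exchange_big/= [leLHS]big_mkcond; apply: ler_sum => t _.
have ge0 k : 0 <= (if bad k t then P t else 0) by case: ifP.
case: ifPn => [/existsP[k /andP[Sk bk]]|_]; last exact: sumr_ge0.
by rewrite (bigD1 k)//= bk lerDl sumr_ge0.
Qed.

(** Two scales of noise. The coarse bound, needed to locate the peak, must hold in all n + 1 bins;
    the fine one is needed only in the at most 24 bins near [x0], so its union bound costs no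
    logarithm. *)
Lemma noise_good (n : nat) (x : 'I_n -> 'I_n.+1 -> R) (alpha x0 : R)
    (B : pred {ffun 'I_n -> {ffun 'I_n.+1 -> bool}}) :
  (1000 <= n)%N -> (forall i j, `|x i j| <= 1) ->
  0 <= alpha -> 256 * 256 * ln n%:R <= n%:R * alpha ^+ 2 ->
  (forall f : {ffun 'I_n -> {ffun 'I_n.+1 -> bool}},
    (forall j, `|\sum_i ((-1) ^+ (~~ f i j) - x i j)| <= n%:R * alpha / 32) ->
    (forall j : 'I_n.+1, `|j%:R - x0| < 6 ->
      `|\sum_i ((-1) ^+ (~~ f i j) - x i j)| <= 200 * Num.sqrt n%:R) -> B f) ->
  9 / 10 <= \sum_(f | B f) bits_pmf _ _ x f.
Proof.
move=> n1000 x1 a0 nalpha BP.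
have n1000R : 1000 <= n%:R :> R by rewrite ler_nat.
have nR : 0 < n%:R :> R by lra.
have n0 : (0 < #|'I_n|)%N by rewrite card_ord; lia.
have P0 f := bits_pmf_ge0 _ _ x f x1.
pose X (f : {ffun 'I_n -> {ffun 'I_n.+1 -> bool}}) j := `|\sum_i ((-1) ^+ (~~ f i j) - x i j)|.
pose far j f := n%:R * alpha / 32 < X f j.
pose near j f := 200 * Num.sqrt n%:R < X f j.
pose S (j : 'I_n.+1) := `|j%:R - x0| < 6 :> R.
have lnn : expR (ln n%:R) = n%:R :> R by rewrite lnK// posrE.
have farle : \sum_(f | [exists j, true && far j f]) bits_pmf _ _ x f <= 1 / 100.
  apply: le_trans (union_bound _ _ _ predT _ P0) _.
  apply: (@le_trans _ _ (\sum_(j < n.+1) 2 / n%:R ^+ 2)).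
    apply: ler_sum => j _.
    apply: le_trans (bits_pmf_tail _ _ _ _ _ n0 x1 _) _.
      by rewrite divr_ge0// mulr_ge0// ltW.
    (* The hypothesis on [alpha] makes the tail exponent at least 2 ln n. *)
    rewrite ler_wpM2l// -lnn -expRM_natl -expRN ler_expR lerN2 lnn card_ord.
    rewrite (_ : _ / (32 * _) = n%:R * alpha ^+ 2 / (128 * 256)); first by lra.
    by field; rewrite gt_eqF.
  rewrite sumr_const card_ord -[leLHS]mulr_natr -natr1 mulrAC ler_pdivrMr ?exprn_gt0//; nra.
have nearle : \sum_(f | [exists j, S j && near j f]) bits_pmf _ _ x f <= 48 / 1250.
  apply: le_trans (union_bound _ _ _ S _ P0) _.
  apply: (@le_trans _ _ (\sum_(j | S j) 2 / 1250)).
    apply: ler_sum => j _.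
    apply: le_trans (bits_pmf_tail _ _ _ _ _ n0 x1 _) _.
      by rewrite mulr_ge0// sqrtr_ge0.
    rewrite ler_wpM2l// exprMn sqr_sqrtr ?ler0n// card_ord.
    rewrite (_ : _ / (32 * _) = 1250); last by field; rewrite gt_eqF.
    by apply: expRN_le_inv; lra.
  by apply: le_trans (sum_near_le _ 6 _ _ _) _; [lra|rewrite natrM; lra].
have := sum_bits_pmf _ _ x; rewrite (bigID B)/=.
suff : \sum_(f | ~~ B f) bits_pmf _ _ x f <= 1 / 100 + 48 / 1250 by lra.
apply: le_trans (lerD farle nearle).
rewrite [leLHS]big_mkcond [X in _ <= X + _]big_mkcond [X in _ <= _ + X]big_mkcond -big_split/=.
apply: ler_sum => f _; have Pf := P0 f.
case: ifPn => [nB|_]; last by rewrite addr_ge0//; case: ifP.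
have [|/existsPn nfar] := boolP [exists j, true && far j f]; first by case: ifP; lra.
have [|/existsPn nnear] := boolP [exists j, S j && near j f]; first by lra.
case/negP: nB; apply: BP => [j|j Sj]; rewrite leNgt.
  exact: nfar.
by have := nnear j; rewrite /S Sj.
Qed.

(** The value of [w] gives each degree the tail exponent 2 ln n, enough for a union bound over the
    nodes. The edge count needs only a constant failure probability, hence a deviation of order
    n. *)
Lemma graph_good (n : nat) (p w : R) (B : pred (graph n)) :
  (1000 <= n)%N -> 0 <= p <= 1 -> 0 <= w -> w ^+ 2 = 16 * n%:R * ln n%:R ->
  (forall E : graph n, simple_graph E -> (forall i, `|edge_dev n p (star n i) E| <= w) ->
    `|edge_dev n p (pairs n) E| <= 40 * n%:R -> B E) ->
  9 / 10 <= \sum_(E : graph n | simple_graph E && B E) gnp_weight p E.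
Proof.
move=> n1000 p01 w0 w2 BP.
have n1000R : 1000 <= n%:R :> R by rewrite ler_nat.
have nR : 0 < n%:R :> R by lra.
have lnn : expR (ln n%:R) = n%:R :> R by rewrite lnK// posrE.
have P0 E := gnp_weight_ge0 n p p01 E.
pose far i (E : graph n) := simple_graph E && (w < `|edge_dev n p (star n i) E|).
have farle : \sum_(E | [exists i, true && far i E]) gnp_weight p E <= 1 / 100.
  apply: le_trans (union_bound _ _ _ predT _ P0) _.
  apply: (@le_trans _ _ (\sum_(i < n) 2 / n%:R ^+ 2)).
    apply: ler_sum => i _; apply: le_trans (gnp_tail n p p01 _ n%:R _ _ _ _ _) _ => //.
    - by apply/fintype.subsetP => e; rewrite inE => /andP[].
    - by rewrite card_star ler_nat leq_pred.
    rewrite ler_wpM2l// -lnn -expRM_natl -expRN ler_expR lerN2 lnn w2.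
    by rewrite (_ : _ / (8 * _) = 2 * ln n%:R)//; field; rewrite gt_eqF.
  rewrite sumr_const card_ord -[leLHS]mulr_natr mulrAC ler_pdivrMr ?exprn_gt0//; nra.
have edgele : \sum_(E : graph n | simple_graph E && (40 * n%:R < `|edge_dev n p (pairs n) E|))
    gnp_weight p E <= 1 / 100.
  apply: le_trans (gnp_tail n p p01 _ (n%:R ^+ 2) _ _ _ _ _) _ => //.
  - rewrite -natrX ler_nat; have := card_draws 'I_n 2.
    rewrite card_ord /pairs => ->; rewrite bin2 -divn2; nia.
  - by rewrite exprn_gt0.
  rewrite (_ : _ / (8 * _) = 200); last by field; rewrite gt_eqF.
  by have := expRN_le_inv (200 : R); lra.
have := sum_gnp_weight n p; rewrite (bigID B)/=.
suff : \sum_(E : graph n | simple_graph E && ~~ B E) gnp_weight p E <= 1 / 100 + 1 / 100 by lra.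
apply: le_trans (lerD farle edgele).
rewrite [leLHS]big_mkcond [X in _ <= X + _]big_mkcond [X in _ <= _ + X]big_mkcond -big_split/=.
apply: ler_sum => E _; have PE := P0 E.
case: ifPn => [/andP[sE nB]|_]; last by apply: addr_ge0; case: ifP.
have [|/existsPn nfar] := boolP [exists i, true && far i E]; first by case: ifP; lra.
rewrite sE/= add0r; have [//|nedge] := ltP (40 * n%:R) _.
case/negP: nB; apply: BP => // i; rewrite leNgt; have := nfar i.
by rewrite /far sE.
Qed.

Lemma expR_half_le2 : expR (1 / 2) <= 2 :> R.
Proof.
have := expR_ge1Dx (- (1 / 2) : R); rewrite expRN => h.
by rewrite -lef_pV2 ?posrE ?expR_gt0//; lra.
Qed.

Lemma ln_inv_ge_half (delta : R) : 0 < delta <= 2^-1 -> 1 / 2 <= ln delta^-1.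
Proof.
move=> /andP[delta0 delta_le].
rewrite -ler_expR lnK ?posrE ?invr_gt0//; apply: (le_trans expR_half_le2).
by rewrite -[leLHS]invrK lef_pV2 ?posrE ?invr_gt0.
Qed.

Lemma ln_ge1 (x : R) : 4 <= x -> 1 <= ln x.
Proof.
move=> x4; rewrite -ler_expR lnK ?posrE; last by lra.
rewrite (_ : 1 = 1 / 2 + 1 / 2 :> R) ?expRD; last by lra.
by have := expR_gt0 (1 / 2 : R); have := expR_half_le2; nra.
Qed.

(** This fixes the constant 4096: its square is 256 * 256 * 256, and eps^2 / (256 l) is alpha^2. *)
Lemma eps_lower_bound (x L l eps : R) : 0 < x -> 0 <= L -> 0 < l ->
  4096 * Num.sqrt (L * l / x) <= eps -> 256 * 256 * L <= x * (eps ^+ 2 / (256 * l)).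
Proof.
move=> x0 L0 l0 ceps.
have q0 := sqrtr_ge0 (L * l / x).
have q2 : Num.sqrt (L * l / x) ^+ 2 * x = L * l.
  rewrite sqr_sqrtr; first by rewrite divfK// gt_eqF.
  by rewrite divr_ge0 ?mulr_ge0// ltW.
rewrite mulrA ler_pdivlMr; last by lra.
have : (4096 * Num.sqrt (L * l / x)) ^+ 2 <= eps ^+ 2.
  move: ceps q0; move: (Num.sqrt _) => q ceps q0.
  have : 0 <= 4096 * q by lra.
  by move: (4096 * q) ceps => u ue u0; nra.
move: (Num.sqrt _) q2 => q q2 qe; clear ceps.
have h : (4096 * q) ^+ 2 * x <= eps ^+ 2 * x by rewrite ler_wpM2r// ltW.
have e : (4096 * q) ^+ 2 * x = 256 * 256 * L * (256 * l).
  by rewrite -[RHS]mulrA (mulrCA L) -q2; ring.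
by rewrite -e (mulrC x).
Qed.

(** Since 80 <= 160 Q and x - 1 >= x / 2, any C >= 2 * (200 * 4096 + 160) works. *)
Lemma error_budget : exists C : R, 0 < C /\ forall x Q : R, 2 <= x -> 1 / 2 <= Q ->
  (200 * 4096 * Q + 80) / (x - 1) <= C * Q / x.
Proof.
exists (1000 * 2000); split=> [|x Q x2 Q2]; first by lra.
rewrite ler_pdivrMr; last by lra.
rewrite [leRHS]mulrAC ler_pdivlMr; last by lra.
by nra.
Qed.

End Accuracy.

(** * Choice of the parameters and conclusion *)

Local Open Scope classical_set_scope.
Local Open Scope ring_scope.

Theorem theorem4p8 (R : realType) :
  exists (c C : R) (n0 : nat), 0 < c /\ 0 < C /\
  forall (n : nat) (delta eps : R),
    (n0 <= n)%N -> 0 < delta <= 2^-1 -> 0 < eps <= 1 ->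
    c * Num.sqrt (ln n%:R * ln delta^-1 / n%:R) <= eps ->
    exists A : local_alg R n,
      local_alg_wf A /\ LNDP A eps delta /\
      forall p : R, 0 <= p <= 1 ->
        ((2 / 3)%:E <=
           gnp_prob A p
             [set x : R | (`|x - p| <= C * (Num.sqrt (ln n%:R) / n%:R)
                                         * (Num.sqrt (ln delta^-1) / eps))%R])%E.
Proof.
have [C [C0 budget]] := error_budget (R := R).
exists 4096, C, 1000%N; split; first by lra.
split; first exact: C0.
move=> n delta eps n1000 delta01 eps01; have [delta0 _] := andP delta01.
have [eps0 eps1] := andP eps01.
have n4 : 4 <= n%:R :> R by rewrite ler_nat; apply: leq_trans n1000.
have n1 : (1 < n)%N by apply: leq_trans n1000.
have nR : 0 < n%:R :> R by apply: lt_le_trans n4.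
have ldelta : expR (- ln delta^-1) = delta by rewrite lnV ?posrE// opprK lnK.
have := ln_inv_ge_half _ delta01; move: (ln delta^-1) ldelta => l ldelta l2.
have l0 : 0 < l by lra.
have L1 := ln_ge1 _ n4; set L := ln n%:R in L1 *.
have L0 : 0 < L by lra.
set sl := Num.sqrt l; set sL := Num.sqrt L; set sn := Num.sqrt (n%:R : R).
have sl2 : sl ^+ 2 = l by rewrite sqr_sqrtr// ltW.
have sL2 : sL ^+ 2 = L by rewrite sqr_sqrtr// ltW.
have sn2 : sn ^+ 2 = n%:R by rewrite sqr_sqrtr.
have sl_gt0 : 0 < sl by rewrite sqrtr_gt0.
have sL_gt0 : 0 < sL by rewrite sqrtr_gt0.
have sn_gt0 : 0 < sn by rewrite sqrtr_gt0.
have sl_ge : 1 / 2 <= sl by nra.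
have sL_ge : 1 <= sL by nra.
have sn_ge : 1 <= sn by nra.
(* The factor 16 in [alpha] makes the sensitivity 3 alpha^2 fit under eps^2 / (64 l) = 4 alpha^2. *)
pose w := 4 * (sn * sL); pose alpha := eps / (16 * sl).
have w1 : 1 <= w by rewrite /w; nra.
have w2 : w ^+ 2 = 16 * n%:R * L by rewrite /w -sn2 -sL2; ring.
have alpha0 : 0 < alpha by rewrite divr_gt0// mulr_gt0.
have alphaM : alpha * (16 * sl) = eps by rewrite /alpha divfK// gt_eqF// mulr_gt0.
have alpha2 : alpha <= 1 / 2 by nra.
have alphasq : alpha ^+ 2 = eps ^+ 2 / (256 * l).
  by rewrite /alpha -sl2; field; rewrite gt_eqF.
move=> /(eps_lower_bound _ _ _ _ nR (ltW L0) l0); rewrite -alphasq.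
move=> /(noise_good n _ alpha _ _ n1000 _ (ltW alpha0)) noise.
have signal_le (N : {set 'I_n}) j : `|signal n w alpha N j| <= 1 / 2.
  have := hat_ge0 j (#|N|%:R / w); have := hat_le1 j (#|N|%:R / w).
  rewrite /signal; move: (hat _ _) => u u1 u0.
  rewrite ger0_norm; last by rewrite mulr_ge0// ltW.
  by apply: le_trans alpha2; rewrite ler_piMr// ltW.
have signal_le1 (N : {set 'I_n}) j : `|signal n w alpha N j| <= 1.
  by apply: le_trans (signal_le N j) _; lra.
pose K N (m : {ffun 'I_n.+1 -> bool}) := \prod_j bit_pmf (signal n w alpha N j) (m j).
have K0 N m : 0 <= K N m by apply: prodr_ge0 => j _; exact: bit_pmf_ge0.
have K1 N : \sum_m K N m = 1.
  rewrite (sum_prod_ffun _ _ (fun j => bit_pmf (signal n w alpha N j))) big1// => j _.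
  exact: sum_bit_pmf.
have [A [wfA privA outA]] :=
  kernel_local_alg n _ [ffun=> true] K (density_estimate n w alpha) K0 K1.
exists A; split => //; split.
  apply: privA => E E' B _ _ EE'; rewrite -[X in _ <= _ + X]ldelta.
  apply: (@bits_pmf_indist R _ _ (fun i => signal n w alpha (nbhd E i))
    (fun i => signal n w alpha (nbhd E' i))) => //.
  apply: le_trans (signal_sensitivity _ _ _ _ _ w1 _ EE') _; first by rewrite w2; nra.
  have : 0 <= eps ^+ 2 / (256 * l) by apply: divr_ge0; [exact: sqr_ge0|lra].
  rewrite alphasq (_ : eps ^+ 2 / (64 * l) = 4 * (eps ^+ 2 / (256 * l))); first by lra.
  by field; rewrite gt_eqF//; lra.
move=> p p01; have [p0 p1] := andP p01.
set T := [set x | _]; rewrite /gnp_prob.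
have accurate (E : graph n) (f : {ffun 'I_n -> {ffun 'I_n.+1 -> bool}}) : simple_graph E ->
    (forall i, `|edge_dev n p (star n i) E| <= w) ->
    `|edge_dev n p (pairs n) E| <= 40 * n%:R ->
    (forall j, `|\sum_i ((-1) ^+ (~~ f i j) - signal n w alpha (nbhd E i) j)| <= n%:R * alpha / 32) ->
    (forall j : 'I_n.+1, `|j%:R - p * n.-1%:R / w| < 6 ->
      `|\sum_i ((-1) ^+ (~~ f i j) - signal n w alpha (nbhd E i) j)| <= 200 * sn) ->
    density_estimate n w alpha f \in T.
  move=> sE Estar Epairs far near; apply/mem_set; rewrite /T/=.
  apply: le_trans (density_estimate_error _ _ _ _ _ _ _ p01 n1 w1 alpha0 sE Estar far near) _.
  have n'E : n.-1%:R = n%:R - 1 :> R by rewrite -subn1 natrB// ltnW.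
  rewrite n'E; set m := n%:R - 1.
  have m0 : 0 < m by rewrite /m; lra.
  pose Q := sL * sl / eps.
  have Q2 : 1 / 2 <= Q by rewrite ler_pdivlMr//; nra.
  (* The 4096 here is 4 * 64 * 16, from [w], the decoding and [alpha]. *)
  have -> : w * (64 * (200 * sn / (n%:R * alpha))) / m = 200 * 4096 * Q / m.
    by rewrite /w /alpha /Q -sn2; field; rewrite !gt_eqF.
  have -> : C * (sL / n%:R) * (sl / eps) = C * Q / n%:R.
    by rewrite /Q; field; rewrite !gt_eqF.
  have : 2 * `|edge_dev n p (pairs n) E| / (n%:R * m) <= 80 / m.
    rewrite ler_pdivrMr ?mulr_gt0// (_ : 80 / m * (n%:R * m) = 80 * n%:R); first by lra.
    by field; rewrite gt_eqF.
  move=> h; apply: (le_trans (lerD (lexx _) h)); rewrite -mulrDl.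
  by apply: budget => //; lra.
(* Graphs on which the coins succeed with probability at least 9/10. They have mass at least 9/10,
   and 81/100 exceeds 2/3. *)
pose B (E : graph n) := 9 / 10 <=
  \sum_(f | density_estimate n w alpha f \in T) \prod_i K (nbhd E i) (f i).
have := graph_good n p w B n1000 p01 (le_trans ler01 w1) w2.
have goodB (E : graph n) : simple_graph E ->
    (forall i, `|edge_dev n p (star n i) E| <= w) ->
    `|edge_dev n p (pairs n) E| <= 40 * n%:R -> B E.
  move=> sE Estar Epairs.
  apply: (noise (fun i => signal n w alpha (nbhd E i)) (p * n.-1%:R / w)
    (fun f => density_estimate n w alpha f \in T)) => //.
  by move=> f far near; exact: (accurate E).
move=> /(_ goodB) graphs.
under eq_bigr do rewrite outA -EFinM.
rewrite sumEFin lee_fin.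
apply: (@le_trans _ _ (\sum_(E : graph n | simple_graph E && B E) gnp_weight p E * (9 / 10))).
  by rewrite -mulr_suml; lra.
rewrite [leRHS](bigID B)/= -[leLHS]addr0 lerD//.
  by apply: ler_sum => E /andP[_ BE]; rewrite ler_wpM2l// gnp_weight_ge0.
apply: sumr_ge0 => E _; rewrite mulr_ge0 ?gnp_weight_ge0//.
by apply: sumr_ge0 => f _; apply: prodr_ge0.
Qed.
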